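(* Let $\mathcal{M}=\{m_1,\ldots,m_K\}$ be a finite set, let $\widehat v:2^{\mathcal{M}}\to[0,1]$ be any fixed function (empirical evaluator), let $\nu:2^{\mathcal{M}}\to\{0,1\}$ be a fixed recovery predicate, and let $\emptyset=\mathcal{C}_0\subseteq\mathcal{C}_1\subseteq\cdots\subseteq\mathcal{C}_h\subseteq\mathcal{M}$ be the nested clearance family, with $|\mathcal{C}_j|=j$, defined in the context. For $0\le j\le h$ let $$\widehat g(j)=\widehat v(\mathcal{M}\setminus\mathcal{C}_j)-\widehat v(\mathcal{M}),$$ let $$\mathcal{J}=\{0\}\cup\bigl\{j\in\{1,\ldots,h\}\;:\;\widehat g(j)>0,\ \nu(\mathcal{M}\setminus\mathcal{C}_j)=1\bigr\},$$ and let $$\widehat j=\min\,\operatorname*{arg\,max}_{j\in\mathcal{J}}\widehat g(j),\qquad \widetilde{\mathcal{M}}=\mathcal{M}\setminus\mathcal{C}_{\widehat j}.$$ Then: (1) $\widehat v(\widetilde{\mathcal{M}})\ge\widehat v(\mathcal{M})$; (2) if $\widehat j>0$, then $\nu(\widetilde{\mathcal{M}})=1$; (3) $\mathcal{C}_{\widehat j}$ has minimal cardinality among all admissible candidates attaining the maximum gain, i.e. $|\mathcal{C}_{\widehat j}|\le|\mathcal{C}_j|$ for every $j\in\mathcal{J}$ with $\widehat g(j)=\max_{k\in\mathcal{J}}\widehat g(k)$.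
   Context: The nested clearance family is built as follows. Each $m_i\in\mathcal{M}$ has an estimated contribution $$\widehat\psi_i=\frac1L\sum_{\ell=1}^{L}\bigl[\widehat v(P_i(\pi^{(\ell)})\cup\{m_i\})-\widehat v(P_i(\pi^{(\ell)}))\bigr]\in\mathbb{R},$$ where $\pi^{(1)},\ldots,\pi^{(L)}$ are given (sampled) orderings of $\mathcal{M}$ and $P_i(\pi)$ is the set of elements preceding $m_i$ in $\pi$. For a tolerance $\tau\ge0$, the operational harmful set is $\widehat{\mathcal{H}}=\{m_i\in\mathcal{M}:\widehat\psi_i<-\tau\}$, and $h=|\widehat{\mathcal{H}}|$. Let $\sigma(1),\ldots,\sigma(h)$ be an enumeration of the indices of the elements of $\widehat{\mathcal{H}}$ with $\widehat\psi_{\sigma(1)}\le\widehat\psi_{\sigma(2)}\le\cdots\le\widehat\psi_{\sigma(h)}$. Then $\mathcal{C}_j=\{m_{\sigma(1)},\ldots,m_{\sigma(j)}\}$ for $0\le j\le h$, with $\mathcal{C}_0=\emptyset$. The indices $j\in\mathcal{J}$ (and the corresponding sets $\mathcal{C}_j$) are called admissible. *)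

(* Defs.v *)
From HB Require Import structures.
From mathcomp Require Import all_boot all_order all_algebra.
From mathcomp Require Import reals.
Set Implicit Arguments.
Unset Strict Implicit.
Unset Printing Implicit Defensive.
Import Order.TTheory GRing.Theory Num.Theory.
Local Open Scope ring_scope.

(* The finite type M is the ground set {m_1, ..., m_K}, K = #|M|; its elements *)
(* serve as their own indices.                                                 *)

Definition is_ordering (M : finType) (p : seq M) : bool :=
  perm_eq p (enum M).

Definition predecessors (M : finType) (p : seq M) (x : M) : {set M} :=
  [set y in take (index x p) p].

Definition contribution (R : realType) (M : finType) (v : {set M} -> R)
    (L : nat) (p : 'I_L -> seq M) (x : M) : R :=
  L%:R^-1 * \sum_(l < L) (v (predecessors (p l) x :|: [set x])
                          - v (predecessors (p l) x)).

Definition harmful (R : realType) (M : finType) (psi : M -> R) (tau : R) :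
    {set M} :=
  [set x | psi x < - tau].

(* Ties in psi may be broken arbitrarily. *)
Definition sorted_enumeration (R : realType) (M : finType) (psi : M -> R)
    (H : {set M}) (s : seq M) : bool :=
  perm_eq s (enum H) && sorted (fun x y => psi x <= psi y) s.

Definition clearance (M : finType) (s : seq M) (j : nat) : {set M} :=
  [set x in take j s].

Definition gain (R : realType) (M : finType) (v : {set M} -> R)
    (C : nat -> {set M}) (j : nat) : R :=
  v ([set: M] :\: C j) - v [set: M].

Definition admissible (R : realType) (M : finType) (v : {set M} -> R)
    (nu : {set M} -> bool) (C : nat -> {set M}) (h : nat) : {set 'I_h.+1} :=
  ord0 |: [set j : 'I_h.+1 | [&& (0 < j)%N, 0 < gain v C j
                               & nu ([set: M] :\: C j)]].

Definition argmax (R : realType) (I : finType) (J : {set I}) (g : I -> R) :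
    {set I} :=
  [set j in J | [forall k in J, g k <= g j]].

(* The default ord0 is returned only for an empty A; ord0 need not lie in A. *)
Definition min_index (h : nat) (A : {set 'I_h.+1}) : 'I_h.+1 :=
  [arg min_(j < ord0 in A) (j : nat)]%N.

Definition selected (R : realType) (M : finType) (v : {set M} -> R)
    (nu : {set M} -> bool) (C : nat -> {set M}) (h : nat) : 'I_h.+1 :=
  min_index (argmax (admissible v nu C h) (fun j => gain v C j)).

(* The initial value is the gain at 0, an index that is always admissible. *)
Definition max_gain (R : realType) (M : finType) (v : {set M} -> R)
    (nu : {set M} -> bool) (C : nat -> {set M}) (h : nat) : R :=
  \big[Num.max/gain v C 0]_(k in admissible v nu C h) gain v C k.

(* Main.v *)
Require Import Defs.
From mathcomp Require Import all_boot all_order all_algebra.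
From mathcomp Require Import reals.
Set Implicit Arguments.
Unset Strict Implicit.
Unset Printing Implicit Defensive.
Import Order.TTheory GRing.Theory Num.Theory.
Local Open Scope ring_scope.

(** Index 0 is always admissible and clears nothing, so its gain is zero and the maximal gain is
    nonnegative; this gives (1). Any other admissible index passes [nu] by the definition of
    [admissible], which gives (2). For (3), the clearance sets are nested prefixes, so the least
    maximising index also has the least cardinality. [selectedP] supplies the facts about the
    selected index, and [clearance_subset] the nesting. *)

(* The default value of [min_index] is immaterial: [arg min] picks a minimiser
   of [A] as soon as one exists, even when [ord0] is not in [A]. *)
Lemma min_indexP (h : nat) (A : {set 'I_h.+1}) (i : 'I_h.+1) :
  i \in A ->
  min_index A \in A /\ (forall j, j \in A -> (min_index A <= j)%N).
Proof.
move=> iA; rewrite /min_index /arg_min /extremum.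
case: pickP => [k /andP[kA /forall_inP k_min] //|no_min].
(* If the search had failed, an [arg min] started at the member [i] of [A] would still produce a
   minimiser. *)
case: (@arg_minnP _ i [in A] (@nat_of_ord _) iA) => k kA k_min.
by have /negP[] := no_min k; apply/andP; split=> //; apply/forall_inP.
Qed.

Lemma argmax_neq0 (R : realType) (I : finType) (J : {set I}) (g : I -> R) i :
  i \in J -> exists j, j \in argmax J g.
Proof.
move=> iJ; case: (@arg_maxP _ R I i [in J] g iJ) => j jJ j_max.
by exists j; rewrite inE; apply/andP; split=> //; apply/forall_inP.
Qed.

Lemma clearance0 (M : finType) (s : seq M) : clearance s 0 = set0.
Proof. by apply/setP => x; rewrite !inE take0. Qed.

Lemma clearance_subset (M : finType) (s : seq M) (i j : nat) :
  (i <= j)%N -> clearance s i \subset clearance s j.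
Proof.
move=> le_ij; apply/subsetP => x; rewrite !inE -(take_takel s le_ij).
exact: mem_take.
Qed.

Section Selection.
Variables (R : realType) (M : finType) (v : {set M} -> R).
Variables (nu : {set M} -> bool) (C : nat -> {set M}) (h : nat).

Let J := admissible v nu C h.

Lemma admissible0 : ord0 \in J.
Proof. by rewrite !inE eqxx. Qed.

(** Pointwise maximality agrees with attaining the big maximum because the initial value
    [gain v C 0] is itself the gain of an admissible index, so it cannot raise the maximum above the
    gains over [J]. *)
Lemma argmax_gainE (j : 'I_h.+1) :
  (j \in argmax J (fun k => gain v C k)) =
  (j \in J) && (gain v C j == max_gain v nu C h).
Proof.
rewrite inE; case: (boolP (j \in J)) => //= jJ.
rewrite eq_le le_bigmax_cond //=; apply/forall_inP/idP => [j_max|j_max k kJ].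
  by apply: bigmax_le => //; exact: (j_max _ admissible0).
by apply: le_trans j_max; rewrite le_bigmax_cond.
Qed.

(** Since 0 lies in [J], the finite set of maximisers is nonempty, so [min_indexP] applies to it. *)
Lemma selectedP :
  [/\ selected v nu C h \in J,
      gain v C (selected v nu C h) = max_gain v nu C h
    & forall j : 'I_h.+1, j \in J -> gain v C j = max_gain v nu C h ->
        (selected v nu C h <= j)%N].
Proof.
have [i iA] := argmax_neq0 (fun k : 'I_h.+1 => gain v C k) admissible0.
have [] := min_indexP iA; rewrite argmax_gainE => /andP[selJ /eqP sel_max] sel_min.
split=> // j jJ j_max; apply: sel_min.
by rewrite argmax_gainE jJ j_max eqxx.
Qed.

End Selection.

Theorem theorem2 (R : realType) (M : finType)
    (v : {set M} -> R) (v01 : forall A : {set M}, 0 <= v A <= 1)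
    (nu : {set M} -> bool)
    (L : nat) (L_gt0 : (0 < L)%N)
    (p : 'I_L -> seq M) (p_ordering : forall l : 'I_L, is_ordering (p l))
    (tau : R) (tau_ge0 : 0 <= tau)
    (s : seq M)
    (s_enum : sorted_enumeration (contribution v p)
                (harmful (contribution v p) tau) s) :
  let h := #|harmful (contribution v p) tau| in
  let C := clearance s in
  let J := admissible v nu C h in
  let jhat := selected v nu C h in
  let Mtilde := [set: M] :\: C jhat in
  [/\ v [set: M] <= v Mtilde,
      (0 < jhat)%N -> nu Mtilde = true
    & [/\ jhat \in J,
          gain v C jhat = max_gain v nu C h
        & forall j : 'I_h.+1, j \in J -> gain v C j = max_gain v nu C h ->
            (#|C jhat| <= #|C j|)%N]].
Proof.
move=> h C J jhat Mtilde.
have [jhatJ jhat_max jhat_min] := selectedP v nu C h.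
split.
(* The difference of values is by definition the gain at [jhat], so it suffices to bound the maximum
   below by the gain at 0. *)
- rewrite -subr_ge0 -[_ - _]/(gain v C jhat) jhat_max.
  have gain0 : gain v C 0 = 0 by rewrite /gain /C clearance0 setD0 subrr.
  by rewrite -{1}gain0; exact: (le_bigmax_cond _ _ (admissible0 v nu C h)).
- move: jhatJ; rewrite !inE => /orP[/eqP jhat0|/and3P[_ _ ->] //].
  (* Here [jhat] is 0, contradicting the premise that it is positive. *)
  by rewrite /jhat jhat0.
- split=> // j jJ j_max.
  by apply/subset_leq_card/clearance_subset/jhat_min.
Qed.
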